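(* There is an absolute constant $C>0$ such that for every integer $N\geq 3$ there is a subset of $\{1,4,9,\dots,N^2\}$ (the set of the first $N$ positive perfect squares) with cardinality at least $$C \cdot N\cdot \exp\left(-2\sqrt{2}\sqrt{\log\log N} + \tfrac14 \log\log\log N\right)$$ that does not contain any 3-term arithmetic progressions, where $\exp(x)=2^x$ and $\log x=\log_2 x$.
   Context: Conventions: $\exp(x)$ denotes $2^x$ and $\log x$ denotes $\log_2(x)$. A $3$-term arithmetic progression is a nonconstant one, i.e. a sequence $a,a+d,a+2d$ with $d\neq 0$. *)

(* Defs.v *)
From mathcomp Require Import all_boot all_order all_algebra finmap.
From mathcomp Require Import reals exp.

Set Implicit Arguments.
Unset Strict Implicit.
Unset Printing Implicit Defensive.

Import Order.TTheory GRing.Theory Num.Theory.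
Local Open Scope ring_scope.

Definition log2 (R : realType) (x : R) : R := ln x / ln 2.

Definition exp2 (R : realType) (x : R) : R := 2 `^ x.

Definition first_squares (N : nat) : {fset int} :=
  [fset (k%:Z ^+ 2 : int) | k in iota 1 N]%fset.

Definition has_3ap (A : {fset int}) : Prop :=
  exists a d : int,
    [/\ d != 0, a \in A, a + d \in A & a + 2 * d \in A].

(* Main.v *)
Require Import Defs.
From HB Require Import structures.
From mathcomp Require Import all_boot all_order all_algebra finmap.
From mathcomp Require Import reals exp.
From mathcomp Require Import zify ring lra.
Import Order.TTheory GRing.Theory Num.Theory.
Local Open Scope nat_scope.

(** A set with few 3-term progressions contains a large progression-free
subset, of a size governed by the number of progressions rather than by the
ambient interval.  The squares up to N^2 contain only O(N log N) progressions,
so log N plays here the role that N plays in the Behrend-Elkin-Green-Wolf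
construction.

Counting.  A progression x^2 < y^2 < z^2 satisfies, with a = z - x and
b = 2y - x - z, the equation a^2 + b^2 = 4by.  Writing a/b = u/v in lowest terms
shows that it is determined by integers k, u > v with k(u^2 + v^2) = 4y
([square_ap_param]).  The number of (k, u, v) with y <= N is at most the sum of
u * (4N / u^2), which is O(N log N) ([card_square_aps]).

Random copies.  Let V be the group of d-tuples modulo a large prime p and let A
be the set of points of the cube [0, p/2)^d whose squared norm lies in a window
of length d m^2.  For random theta and alpha in V, keep the n for which
theta n^2 + alpha lies in A.  On average N |A| / |V| integers are kept.  If a
progression is kept, its image is u, u + v, u + 2v in A; because A lies in half
of the torus there is no wraparound, and the parallelogram law bounds the norm
of v ([halfcube_step]).  Only (8m)^d values of v are that short
([card_small_steps]), and (u, v) is uniform in V^2, so few progressions survive.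
One deletes an element from each ([random_affine_copy]).

Choice of the window.  The squared norm concentrates in an interval of length
O(sqrt(d) p^2) around its mean, so by Chebyshev and the pigeonhole principle a
window of length d m^2 can be found that captures a proportion of order
sqrt(d) (m/p)^2 of the cube ([spherical_shell]).  Working with a window around
the typical norm, instead of a single sphere, is what yields the factor sqrt(d).

Optimization.  Deletion is affordable when (8m/p)^d is at most a small multiple
of 1 / log N.  Then the density is about
2^(-d) sqrt(d) (log N)^(-2/d), and d close to sqrt(2 log log N) makes the exponent
d + 2 (log log N) / d equal to 2 sqrt(2 log log N) up to a constant, while sqrt(d)
is at least (log log N)^(1/4). *)

(** * Three-term progressions of squares *)

(** Each dyadic block of values of [u] contributes at most [n]. *)
Lemma sum_divn_dyadic n j : \sum_(1 <= u < 2 ^ j) n %/ u <= j * n.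
Proof.
elim: j => [|j IHj]; first by rewrite expn0 big_geq.
rewrite (@big_cat_nat _ _ _ (2 ^ j)) ?expn_gt0 ?leq_exp2l //= mulSn addnC.
apply: leq_add => //; apply: leq_trans (leq_divM n (2 ^ j)).
apply: leq_trans (_ : \sum_(2 ^ j <= u < 2 ^ j.+1) n %/ 2 ^ j <= _).
  rewrite !big_nat; apply: leq_sum => u /andP[ju _].
  by apply: leq_div2l; rewrite ?expn_gt0.
by rewrite sum_nat_const_nat expnS mul2n -addnn addnK mulnC.
Qed.

(** With [a = z - x] and [b = 2 * y - x - z] the equation reads
[a ^ 2 + b ^ 2 = 4 * b * y].  If [g] is the gcd and [a = g * u], [b = g * v], then
[g * (u ^ 2 + v ^ 2) = 4 * v * y], and [v] is prime to [u ^ 2 + v ^ 2], hence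
[u ^ 2 + v ^ 2] divides [4 * y].  Unlike the classical parametrization of
Pythagorean triples, this one needs no discussion of parity. *)
Lemma square_ap_param x y z : 0 < x -> x < z -> x ^ 2 + z ^ 2 = 2 * y ^ 2 ->
  exists k u v, [/\ 0 < k, v < u, k * (u ^ 2 + v ^ 2) = 4 * y,
    z = x + k * u * v & x + z + k * v ^ 2 = 2 * y].
Proof.
move=> x0 xz eq.
have yz : y < z by nia.
have sum_lt : x + z < 2 * y by nia.
set a := z - x; set b := 2 * y - (x + z).
have a0 : 0 < a by rewrite subn_gt0.
have b0 : 0 < b by rewrite subn_gt0.
have ba : b < a by rewrite /a /b; lia.
have ab : a ^ 2 + b ^ 2 = 4 * (b * y) by rewrite /a /b; nia.
pose g := gcdn a b.
have g0 : 0 < g by rewrite gcdn_gt0 a0.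
have /dvdnP[u au] : g %| a by apply: dvdn_gcdl.
have /dvdnP[v bv] : g %| b by apply: dvdn_gcdr.
have cuv : coprime u v.
  rewrite /coprime -(eqn_pmul2r g0) mul1n muln_gcdl -au -bv; exact/eqP.
have v0 : 0 < v by move: b0; rewrite bv muln_gt0 => /andP[].
have guv : g * (u ^ 2 + v ^ 2) = 4 * (v * y).
  apply/eqP; rewrite -(eqn_pmul2l g0); apply/eqP; move: ab; rewrite au bv; nia.
have /dvdnP[k ky] : u ^ 2 + v ^ 2 %| 4 * y.
  rewrite -(@Gauss_dvdr _ v) ?[v * _]mulnCA -?guv ?dvdn_mull //.
  rewrite coprime_sym -coprime_modr -[v ^ 2]mulnn addnC modnMDl coprime_modr.
  by rewrite coprimeXr // coprime_sym.
have gk : g = k * v.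
  apply/eqP; rewrite -(@eqn_pmul2r (u ^ 2 + v ^ 2)); last by nia.
  by rewrite guv mulnAC -ky [_ * v]mulnC mulnCA.
exists k, u, v; split => //.
- by rewrite gk muln_gt0 in g0; case/andP: g0.
- by move: ba; rewrite au bv ltn_pmul2r.
- by move: au; rewrite gk /a; nia.
- by move: bv; rewrite gk /b; nia.
Qed.

(** The indices are the roots, listed in increasing order with the middle term
in second position. *)
Definition square_aps N : {set 'I_N.+1 * 'I_N.+1 * 'I_N.+1} :=
  [set t : 'I_N.+1 * 'I_N.+1 * 'I_N.+1 | [&& 0 < t.1.1, t.1.1 < t.2 &
                (t.1.1 ^ 2 + t.2 ^ 2 == 2 * t.1.2 ^ 2)]].

(** The parameters [(u, v, k)] determine the triple, and for given [u] there are
[u] choices of [v] and at most [4 * N %/ u ^ 2] choices of [k]: this leaves a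
harmonic sum. *)
Lemma card_square_aps N : #|square_aps N| <= (trunc_log 2 N + 3) * (4 * N).
Proof.
pose decode u (vk : nat * nat) : 'I_N.+1 * 'I_N.+1 * 'I_N.+1 :=
  let: (v, k) := vk in
  let y := k * (u ^ 2 + v ^ 2) %/ 4 in
  let x := (2 * y - k * v ^ 2 - k * u * v) %/ 2 in
  (inord x, inord y, inord (x + k * u * v)).
pose codes := [seq decode u vk | u <- index_iota 1 (4 * N).+1,
  vk <- [seq (v, k) | v <- iota 0 u, k <- iota 1 (4 * N %/ u ^ 2)]].
have sub : square_aps N \subset codes.
  apply/subsetP=> -[[x y] z]; rewrite inE /= => /and3P[x0 xz /eqP eq].
  have [k [u [v [k0 vu ky zE xzE]]]] := @square_ap_param x y z x0 xz eq.
  have yN : y <= N by rewrite -ltnS.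
  have u0 : 0 < u by apply: leq_ltn_trans vu.
  have kuN : k * u ^ 2 <= 4 * N.
    by apply: leq_trans (_ : 4 * y <= _); rewrite ?leq_mul2l ?yN // -ky mulnDr leq_addr.
  have uN : u <= 4 * N.
    apply: leq_trans kuN; rewrite -{1}[u]mul1n; apply: leq_mul => //.
    by rewrite -{1}[u]muln1 -mulnn leq_mul2l u0 orbT.
  apply/allpairsPdep; exists u, (v, k); split.
  - by rewrite mem_index_iota u0 ltnS.
  - apply/allpairsPdep; exists v, k; rewrite !mem_iota k0 vu add1n ltnS.
    by split=> //; rewrite leq_divRL ?expn_gt0 ?u0.
  rewrite /decode ky mulKn //.
  have -> : (2 * y - k * v ^ 2 - k * u * v) %/ 2 = x.
    by rewrite -xzE addnK zE addnA addnK addnn -muln2 mulnK.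
  by rewrite -zE !inord_val.
apply: leq_trans (subset_leq_card sub) _; apply: leq_trans (card_size _) _.
rewrite size_allpairs_dep sumnE big_map.
have leN : (4 * N).+1 <= 2 ^ (trunc_log 2 N + 3).
  have := @trunc_log_ltn 2 N isT; rewrite addn3 !expnS; lia.
apply: leq_trans (sum_divn_dyadic _ _).
rewrite [leqRHS](@big_cat_nat _ _ _ (4 * N).+1) //=; apply: leq_trans (leq_addr _ _).
rewrite big_nat [leqRHS]big_nat; apply: leq_sum => u /andP[u0 _].
rewrite size_allpairs !size_iota leq_divRL // mulnAC mulnn mulnC.
exact: leq_divM.
Qed.

(** * Spherical shells in a discrete cube *)

Section SecondMoment.
Local Open Scope ring_scope.
Variables (R : comPzRingType) (I J : finType).

Lemma sum_ffun_coord (f : J -> R) (i : I) :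
  (\sum_(x : {ffun I -> J}) f (x i)) * #|J|%:R
    = #|J|%:R ^+ #|I| * \sum_j f j.
Proof.
pose F k j := if k == i then f j else 1.
have FE (x : {ffun I -> J}) : f (x i) = \prod_k F k (x k).
  by rewrite (bigD1 i) //= /F eqxx big1 ?mulr1 // => k /negPf ->.
under eq_bigr do rewrite FE.
rewrite -bigA_distr_bigA (bigD1 i) //= {1}/F eqxx.
have -> : \prod_(k | k != i) \sum_j F k j = \prod_(k | k != i) #|J|%:R.
  by apply: eq_bigr => k /negPf ki; rewrite /F ki sumr_const.
rewrite prodr_const mulrAC -mulrA -exprS mulrC; congr (_ ^+ _ * _).
by rewrite [RHS](cardD1 i) add1n; congr _.+1; apply: eq_card => k; rewrite !inE andbT.
Qed.

Lemma sum_ffun_coord2 (f : J -> R) (i k : I) : i != k -> \sum_j f j = 0 ->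
  \sum_(x : {ffun I -> J}) f (x i) * f (x k) = 0.
Proof.
move=> ik f0; pose F l j := if l \in [set i; k] then f j else 1.
have FE (x : {ffun I -> J}) : f (x i) * f (x k) = \prod_l F l (x l).
  rewrite (bigD1 i) // (bigD1 k) /=; last by rewrite eq_sym.
  rewrite /F !inE !eqxx orbT big1 ?mulr1 // => l /andP[/negPf li /negPf lk].
  by rewrite !inE li lk.
under eq_bigr do rewrite FE.
rewrite -bigA_distr_bigA (bigD1 i) //= {1}/F !inE eqxx.
by rewrite f0 mul0r.
Qed.

(** Distinct coordinates are independent, so the cross terms vanish. *)
Lemma second_moment (f : J -> R) : \sum_j f j = 0 ->
  (\sum_(x : {ffun I -> J}) (\sum_i f (x i)) ^+ 2) * #|J|%:R
    = #|I|%:R * #|J|%:R ^+ #|I| * \sum_j f j ^+ 2.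
Proof.
move=> f0.
transitivity ((\sum_i \sum_k \sum_(x : {ffun I -> J}) f (x i) * f (x k)) * #|J|%:R).
  congr (_ * _); under eq_bigr do rewrite expr2 big_distrlr /=.
  by rewrite exchange_big; apply: eq_bigr => i _; rewrite exchange_big.
rewrite big_distrl /= (eq_bigr (fun=> #|J|%:R ^+ #|I| * \sum_j f j ^+ 2)).
  by rewrite sumr_const -[RHS]mulrA mulr_natl.
move=> i _; rewrite (bigD1 i) //= [X in _ + X]big1 ?addr0; last first.
  by move=> k ki; apply: sum_ffun_coord2 => //; rewrite eq_sym.
exact: sum_ffun_coord.
Qed.

End SecondMoment.

Definition sqnorm {d M} (x : {ffun 'I_d -> 'I_M}) := \sum_i x i ^ 2.

(** The squared norm is a sum of [d] independent variables bounded by [M ^ 2], so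
by Chebyshev at least 3/4 of the cube has squared norm within
[2 * s * M ^ 2] of the mean, where [s] is an upper bound for the standard
deviation factor [sqrt d].  This interval is cut into windows of length [w], and
the fullest one is kept. *)
Lemma spherical_shell d M w s : 0 < M -> 0 < w -> 0 < s -> d <= s ^ 2 ->
  exists A : {set {ffun 'I_d -> 'I_M}},
    {in A &, forall x y, sqnorm x < sqnorm y + w} /\
    3 * M ^ d <= 4 * #|A| * (4 * s * M ^ 2 %/ w).+1.
Proof.
move=> M0 w0 s0 ds.
pose S := \sum_(k < M) k ^ 2.
(* Centering multiplies everything by [M], which keeps the values integral. *)
pose g (k : 'I_M) : int := ((M * k ^ 2)%:Z - S%:Z)%R.
have g0 : (\sum_k g k = 0)%R.
  rewrite sumrB sumr_const card_ord -(big_morph Posz PoszD (erefl _)).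
  rewrite -big_distrr /= -/S; lia.
have gM k : (g k ^+ 2 <= (M ^ 6)%:Z)%R.
  have kM : k ^ 2 <= M ^ 2 by rewrite leq_exp2r // ltnW.
  have SM : S <= M ^ 3.
    apply: leq_trans (_ : \sum_(k < M) M ^ 2 <= _).
      by apply: leq_sum => i _; rewrite leq_exp2r // ltnW.
    by rewrite sum_nat_const card_ord -expnS.
  have : M * k ^ 2 <= M ^ 3 by rewrite expnS leq_mul2l kM orbT.
  have -> : ((M ^ 6)%:Z = (M ^ 3)%:Z ^+ 2)%R by rewrite expr2 -PoszM -expnD.
  rewrite /g; move: (M * k ^ 2) (M ^ 3) SM => a b; nia.
pose G (x : {ffun 'I_d -> 'I_M}) : int := ((M * sqnorm x)%:Z - (d * S)%:Z)%R.
have GE x : (G x = \sum_i g (x i))%R.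
  rewrite sumrB sumr_const card_ord -(big_morph Posz PoszD (erefl _)).
  by rewrite -big_distrr /= -/(sqnorm x) /G; lia.
pose bad := [set x | ((4 * (s * M ^ 3) ^ 2)%:Z <= G x ^+ 2)%R].
have badM : 4 * #|bad| <= M ^ d.
  have sm := @second_moment int 'I_d 'I_M g g0; rewrite !card_ord in sm.
  have up : (\sum_(x in bad) (4 * (s * M ^ 3) ^ 2)%:Z
      <= \sum_(x : {ffun 'I_d -> 'I_M}) (\sum_i g (x i)) ^+ 2)%R.
    rewrite [leRHS](bigID (mem bad)) /=; apply: ler_wpDr.
      by apply: sumr_ge0 => x _; apply: sqr_ge0.
    by apply: ler_sum => x; rewrite inE GE.
  have sumg : (\sum_j g j ^+ 2 <= (M ^ 7)%:Z)%R.
    apply: le_trans (_ : \sum_(j < M) (M ^ 6)%:Z <= _)%R; first exact: ler_sum.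
    by rewrite sumr_const card_ord -mulr_natl natz expnS PoszM.
  move: up; rewrite sumr_const => up.
  rewrite -(leq_pmul2r (_ : 0 < s ^ 2 * M ^ 7)); last by rewrite muln_gt0 !expn_gt0 s0 M0.
  apply: leq_trans (_ : d * M ^ d * M ^ 7 <= _); last first.
    by rewrite [d * _]mulnC -mulnA leq_mul2l leq_mul2r ds !orbT.
  have -> : 4 * #|bad| * (s ^ 2 * M ^ 7) = 4 * (s * M ^ 3) ^ 2 * #|bad| * M by ring.
  rewrite -mulr_natr natz -PoszM in up.
  have M_ge0 : (0 <= M%:Z)%R by [].
  rewrite -lez_nat PoszM; apply: le_trans (ler_wpM2r M_ge0 up) _.
  rewrite -[Posz M]natz sm -natrX -natrM natz [leRHS]PoszM.
  exact: ler_wpM2l.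
(* [c] is the integer part of the mean of the squared norm. *)
pose c := d * S %/ M.
pose r (x : {ffun 'I_d -> 'I_M}) := sqnorm x + 2 * s * M ^ 2 - c.
have good x : x \in ~: bad ->
   [/\ c <= sqnorm x + 2 * s * M ^ 2 & r x <= 4 * s * M ^ 2].
  rewrite !inE -ltNge /G /r.
  have := divn_eq (d * S) M; have := ltn_pmod (d * S) M0; rewrite -/c.
  move: (d * S) (d * S %% M) => D e eM ->.
  move: (sqnorm x) => n.
  have -> : s * M ^ 3 = M * (s * M ^ 2) by ring.
  rewrite -[2 * s * _]mulnA -[4 * s * _]mulnA; move: (s * M ^ 2) => K lt.
  have [lt1 lt2] : M * n < c * M + e + 2 * (M * K) /\
                   c * M + e < M * n + 2 * (M * K).
    move: (M * n) (c * M + e) (M * K) lt => a b T; rewrite expr2 -mulnn => lt.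
    split; nia.
  have [] : n < c + 2 * K + 1 /\ c < n + 2 * K + 1 by split; nia.
  by lia.
pose q x := r x %/ w.
set J := 4 * s * M ^ 2 %/ w.
pose class (j : 'I_J.+1) := [set x in ~: bad | inord (q x) == j].
have [j jP] : exists j, #|~: bad| <= #|class j| * J.+1.
  exists [arg max_(j > ord0) #|class j|]; case: arg_maxnP => // j _ jmax.
  rewrite -sum1_card (partition_big (fun x => inord (q x) : 'I_J.+1) xpredT) //=.
  apply: leq_trans (_ : \sum_(i < J.+1) #|class j| <= _); last first.
    by rewrite sum_nat_const card_ord mulnC.
  apply: leq_sum => i _; apply: leq_trans (jmax i isT).
  by rewrite -sum1_card leq_eqVlt; apply/orP; left; apply/eqP/eq_bigl => x; rewrite !inE.
exists (class j); split.
  move=> x y; rewrite [x \in _]inE [y \in _]inE => /andP[/good[cx rx] /eqP qx] /andP[/good[cy ry] /eqP qy].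
  have {}qx : q x = j by rewrite -qx inordK // ltnS leq_div2r.
  have {}qy : q y = j by rewrite -qy inordK // ltnS leq_div2r.
  have := divn_eq (r x) w; have := divn_eq (r y) w.
  rewrite -/(q x) -/(q y) qx qy.
  have := ltn_pmod (r x) w0; have := ltn_pmod (r y) w0.
  move: cx cy; rewrite /r; lia.
rewrite -mulnA; apply: leq_trans (leq_mul (leqnn 4) jP).
have := cardsC bad; rewrite card_ffun !card_ord; lia.
Qed.

(** * Progressions of the torus inside a thin shell of the half-cube *)

(** The distance from [a] to 0 on the cycle of integers modulo [q.+1]. *)
Definition znorm {q} (a : 'I_q.+1) := minn a (q.+1 - a).

(** Geometric series, stated with its remainder so that the induction closes. *)
Lemma sum_exp_divn m n : 0 < m ->
  (\sum_(0 <= k < m * n) 2^-1 ^+ (k %/ m) + 2 * m%:R * 2^-1 ^+ n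
     = 2 * m%:R :> rat)%R.
Proof.
move=> m0; elim: n => [|n IHn]; first by rewrite muln0 big_geq // add0r expr0 mulr1.
rewrite (@big_cat_nat _ _ _ (m * n)) ?leq_mul2l ?leqnSn ?orbT //=.
rewrite [X in (_ + X + _)%R](_ : _ = m%:R * 2^-1 ^+ n)%R.
  by rewrite -addrA -[in RHS]IHn exprS; congr (_ + _)%R; field.
rewrite big_nat (eq_bigr (fun=> 2^-1 ^+ n)%R) -?big_nat.
  by rewrite sumr_const_nat mulnS addnK mulr_natl.
move=> k /andP[lo hi]; congr (_ ^+ _)%R; apply/eqP.
by rewrite eqn_leq leq_divRL // mulnC lo andbT -ltnS ltn_divLR // mulnC hi.
Qed.

Lemma sum_exp_divn_le m n : 0 < m ->
  (\sum_(0 <= k < n) 2^-1 ^+ (k %/ m) <= 2 * m%:R :> rat)%R.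
Proof.
move=> m0; rewrite -(sum_exp_divn m n) // [X in (_ <= X + _)%R](@big_cat_nat _ _ _ n) //=; last first.
  by rewrite leq_pmull.
rewrite -addrA lerDl addr_ge0 //; last by rewrite !mulr_ge0 ?exprn_ge0.
by apply: sumr_ge0 => i _; rewrite exprn_ge0.
Qed.

Lemma sum_exp_znorm q m : 0 < m ->
  (\sum_(a : 'I_q.+1) 2^-1 ^+ (znorm a %/ m) <= 4 * m%:R :> rat)%R.
Proof.
move=> m0.
pose F k : rat := (2^-1 ^+ (k %/ m))%R.
have F0 k : (0 <= F k)%R by rewrite exprn_ge0.
apply: le_trans (_ : \sum_(a < q.+1) F a + \sum_(a < q.+1) F (q.+1 - a)%N <= _)%R.
  rewrite -big_split; apply: ler_sum => a _ /=.
  suff : (F (znorm a) <= F a + F (q.+1 - a)%N)%R by [].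
  by rewrite /znorm /minn; case: ifP => _; rewrite ?lerDl ?lerDr F0.
have -> : (4 * m%:R = 2 * m%:R + 2 * m%:R :> rat)%R by ring.
apply: lerD; first by rewrite -(big_mkord xpredT F) sum_exp_divn_le.
apply: le_trans (sum_exp_divn_le m q.+2 m0).
rewrite big_nat_recl // ler_wpDl ?F0 // big_mkord.
rewrite (reindex_inj rev_ord_inj) /=; apply: ler_sum => a _.
by rewrite /F subKn.
Qed.

(** Exponential moments: a coordinate [a] is given the weight 2 to the power
[- (znorm a %/ m)].  Every counted vector has total weight at least 2 to the
power [- d], because [g <= g ^ 2] turns the bound on squares into a bound on the
sum of the [znorm (y i) %/ m]; and the weights of all vectors add up to the [d]-th
power of a one-dimensional sum, which is at most [4 * m]. *)
Lemma card_small_steps d q m : 0 < m ->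
  #|[set y : {ffun 'I_d -> 'I_q.+1} | \sum_i znorm (y i) ^ 2 < d * m ^ 2]|
    <= (8 * m) ^ d.
Proof.
move=> m0; set B := [set _ | _].
pose W (a : 'I_q.+1) : rat := (2^-1 ^+ (znorm a %/ m))%R.
have WB y : y \in B -> (2^-1 ^+ d <= \prod_i W (y i))%R.
  rewrite inE => yB; rewrite prodrXr ler_wiXn2l //.
  rewrite -(leq_pmul2r (_ : 0 < m ^ 2)) ?expn_gt0 ?m0 //.
  apply: leq_trans (ltnW yB); rewrite big_distrl /=; apply: leq_sum => i _.
  have := leq_divM (znorm (y i)) m.
  move: (znorm _) (_ %/ m) => a g ga.
  apply: leq_trans (_ : (g * m) ^ 2 <= _); last by rewrite leq_exp2r.
  by rewrite expnMn leq_mul2r; apply/orP; right; nia.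
have sumB : (\sum_(y in B) 2^-1 ^+ d <= (4 * m%:R) ^+ d :> rat)%R.
  apply: le_trans (_ : \sum_(y : {ffun 'I_d -> 'I_q.+1}) \prod_i W (y i) <= _)%R.
    rewrite [leRHS](bigID (mem B)) /= ler_wpDr ?ler_sum //.
    by apply: sumr_ge0 => y _; apply: prodr_ge0 => i _; rewrite exprn_ge0.
  rewrite -(bigA_distr_bigA (fun=> W)) prodr_const card_ord lerXn2r ?nnegrE //.
  - by apply: sumr_ge0 => i _; rewrite exprn_ge0.
  - by rewrite mulr_ge0.
  - exact: sum_exp_znorm.
rewrite -(ler_nat rat) natrX natrM.
have -> : (8 * m%:R = 2 * (4 * m%:R) :> rat)%R by ring.
rewrite exprMn -ler_pdivrMl ?exprn_gt0 // -exprVn.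
by move: sumB; rewrite sumr_const -[leLHS]mulr_natr.
Qed.

(** Three points of [0, p/2) in progression modulo [p] are in progression as
integers, since [a + c] and [2 * b] are congruent and both less than [p].  As
[minn y (p - y)] is at most the distance from [a] to [b], the inequality follows from the parallelogram law
[a ^ 2 + c ^ 2 = 2 * b ^ 2 + 2 * (b - a) ^ 2]. *)
Lemma halfcube_step p M a b c y : 2 * M <= p.+1 -> a < M -> b < M -> c < M ->
  y < p -> b = (a + y) %% p -> c = (b + y) %% p ->
  2 * minn y (p - y) ^ 2 + 2 * b ^ 2 <= a ^ 2 + c ^ 2.
Proof.
move=> Mp aM bM cM yp.
have [ay|ay] := ltnP (a + y) p.
  rewrite modn_small // => bE.
  have [bY|bY] := ltnP (b + y) p.
    rewrite modn_small // => cE; have := geq_minl y (p - y).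
    move: (minn _ _) => u uy; subst b c; nia.
  lia.
rewrite -(subnK ay) modnDr modn_small; last lia.
move=> bE; have [bY|bY] := ltnP (b + y) p; first by rewrite modn_small //; lia.
rewrite -(subnK bY) modnDr modn_small; last lia.
move=> cE; have := geq_minr y (p - y); move: (minn _ _) => u uy.
have [aE bE'] : a = c + (p - y) + (p - y) /\ b = c + (p - y) by lia.
by move: uy; rewrite bE' aE; move: (p - y) => v uv; nia.
Qed.

(** * Random affine copies and deletion *)

(** First moment method over the random map [n |-> theta *+ n + alpha].  The
position [theta *+ c x + alpha] and the step [theta *+ (c y - c x)] of a progression
are independent and uniform, because multiplication by [c y - c x] is injective;
so at most [#|A| * #|B|] of the [#|V| ^ 2] maps send it into [A].  The hypothesis on
[#|T|] makes the expected number of surviving progressions at most half of the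
expected number of elements kept. *)
Lemma random_affine_copy (V : finZmodType) (I : finType) (S : {set I})
    (c : I -> nat) (T : {set I * I * I}) (A B : {set V}) :
    (forall x y z, (x, y, z) \in T -> c x <= c y /\ c z = c y + (c y - c x)) ->
    (forall x y z, (x, y, z) \in T -> injective (fun v : V => (v *+ (c y - c x))%R)) ->
    (forall u v, u \in A -> (u + v)%R \in A -> (u + v + v)%R \in A -> v \in B) ->
    2 * (#|T| * #|B|) <= #|S| * #|V| ->
  exists S' : {set I}, [/\ S' \subset S,
    forall x y z, (x, y, z) \in T -> x \in S' -> y \in S' -> z \in S' -> False &
    #|S| * #|A| <= 2 * #|V| * #|S'|].
Proof.
move=> Tap Tinj AB few.
pose f (p : V * V) i : V := (p.1 *+ c i + p.2)%R.
pose kept p := [set i in S | f p i \in A].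
pose hits p (t : I * I * I) := [&& f p t.1.1 \in A, f p t.1.2 \in A & f p t.2 \in A].
pose caught p := [set t in T | hits p t].
have sum_kept : \sum_p #|kept p| = #|S| * (#|V| * #|A|).
  transitivity (\sum_p \sum_(i in S) (f p i \in A : nat)).
    apply: eq_bigr => p _; rewrite -sum1_card big_mkcond [RHS]big_mkcond /=.
    by apply: eq_bigr => i _; rewrite inE; case: (i \in S); case: (_ \in A).
  rewrite exchange_big /= -sum_nat_const; apply: eq_bigr => i _.
  rewrite -(pair_bigA _ (fun u v => (f (u, v) i \in A : nat))) /= -sum_nat_const.
  apply: eq_bigr => u _; rewrite /f /= -sum1_card [RHS]big_mkcond /=.
  rewrite [RHS](reindex_inj (addrI (u *+ c i)%R)).
  by apply: eq_bigr => v _; case: (_ \in A).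
have sum_caught : \sum_p #|caught p| <= #|T| * (#|A| * #|B|).
  have -> : \sum_p #|caught p| = \sum_(t in T) #|[set p | hits p t]|.
    transitivity (\sum_p \sum_(t in T) (hits p t : nat)).
      apply: eq_bigr => p _; rewrite -sum1_card big_mkcond [RHS]big_mkcond /=.
      by apply: eq_bigr => t _; rewrite inE; case: (t \in T); case: (hits p t).
    rewrite exchange_big /=; apply: eq_bigr => t _.
    rewrite -sum1_card [RHS]big_mkcond /=.
    by apply: eq_bigr => p _; rewrite inE; case: (hits p t).
  rewrite -sum_nat_const; apply: leq_sum => -[[x y] z] txyz.
  have [cxy czE] := Tap _ _ _ txyz.
  pose phi (p : V * V) : V * V := (f p x, (p.1 *+ (c y - c x))%R).
  have phi_inj : injective phi.
    move=> [u v] [u' v'] [] /[swap] /(Tinj _ _ _ txyz) /= -> .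
    by rewrite /f /= => /addrI ->.
  have step p i j : c i <= c j -> (f p j = f p i + p.1 *+ (c j - c i))%R.
    by move=> ij; rewrite /f -{1}(subnKC ij) mulrnDr addrAC.
  rewrite -cardsX -(card_imset _ phi_inj); apply: subset_leq_card.
  apply/subsetP => _ /imsetP[p + ->]; rewrite inE /hits /= => /and3P[fx fy fz].
  rewrite inE /= fx /=; apply: (AB (f p x)) => //; first by rewrite -step.
  rewrite -step //; suff <- : f p z = (f p y + p.1 *+ (c y - c x))%R by [].
  by rewrite (step p y z) czE ?leq_addr // addKn.
have [p pP] : exists p, #|S| * #|A| + 2 * #|V| * #|caught p| <= 2 * #|V| * #|kept p|.
  apply/existsP; apply: contraT; rewrite negb_exists => /forallP noP.
  have V0 : 0 < #|V| by apply/card_gt0P; exists 0%R.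
  have : \sum_p (2 * #|V| * #|kept p|).+1 <=
         \sum_(p : V * V) (#|S| * #|A| + 2 * #|V| * #|caught p|).
    by apply: leq_sum => p _; rewrite ltnNge noP.
  rewrite big_split /= -!big_distrr /= sum_nat_const card_prod.
  under eq_bigr do rewrite -addn1.
  rewrite big_split /= sum1_card card_prod -big_distrr /= sum_kept.
  have : 2 * #|V| * (\sum_p #|caught p|) <= #|V| * (#|A| * (#|S| * #|V|)).
    apply: leq_trans (_ : 2 * #|V| * (#|T| * (#|A| * #|B|)) <= _).
      by rewrite leq_mul2l sum_caught orbT.
    have -> : 2 * #|V| * (#|T| * (#|A| * #|B|)) = #|V| * (#|A| * (2 * (#|T| * #|B|))) by ring.
    by rewrite !leq_mul2l few !orbT.
  move: V0 {Tap Tinj AB few sum_kept sum_caught noP}.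
  move: #|V| #|S| #|A| (\sum_p _) => v s a C; nia.
exists (kept p :\: [set t.1.1 | t in caught p]); split.
- by apply: subset_trans (subsetDl _ _) _; apply/subsetP => i; rewrite inE => /andP[].
- move=> x y z txyz; rewrite !inE => /andP[/imsetP xn /andP[_ fx]].
  move=> /andP[_ /andP[_ fy]] /andP[_ /andP[_ fz]].
  by apply: xn; exists (x, y, z) => //; rewrite inE txyz /hits /= fx fy.
have caught_le : #|[set t.1.1 | t in caught p]| <= #|caught p| := leq_imset_card _ _.
have kept_le : #|kept p| <= #|kept p :\: [set t.1.1 | t in caught p]| + #|caught p|.
  have := cardsID [set t.1.1 | t in caught p] (kept p).
  have := subset_leq_card (subsetIr (kept p) [set t.1.1 | t in caught p]); lia.
rewrite -(leq_add2r (2 * #|V| * #|caught p|)) (leq_trans pP) // -mulnDr.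
by rewrite leq_mul2l kept_le orbT.
Qed.

(** The averaging argument runs over a finite abelian group; this makes the torus
one. *)
HB.instance Definition _ (I : finType) (W : finZmodType) :=
  GRing.Zmodule.on {ffun I -> W}.

Lemma mulrn_ffun_Zp_inj d q D : prime q.+1 -> 0 < D < q.+1 ->
  injective (fun v : {ffun 'I_d -> 'I_q.+1} => (v *+ D)%R).
Proof.
move=> q_pr /andP[D0 Dq] u v /ffunP uv; apply/ffunP => i; apply/val_inj.
have := uv i; rewrite !ffunMnE !Zp_mulrn => /(congr1 val) /= /eqP.
have cop : coprime q.+1 D by rewrite prime_coprime // gtnNdvd.
have dvd_le (a b : 'I_q.+1) : a <= b -> b * D == a * D %[mod q.+1] -> a = b :> nat.
  move=> ab; rewrite eqn_mod_dvd ?leq_mul2r ?ab ?orbT // -mulnBl Gauss_dvdl //.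
  have [->//|ltab] := eqVneq (a : nat) b.
  by rewrite gtnNdvd //; have := ltn_ord b; lia.
by case/orP: (leq_total (u i) (v i)) => /dvd_le h; [rewrite eq_sym|] => /h.
Qed.

(** The half-cube has side [M], that is half of the odd prime [q.+1] rounded up.
The factor 2 ^ d is its share of the torus. *)
Lemma square_ap_free_subset N d s q m M : 1 < N -> 0 < d -> 0 < s -> d <= s ^ 2 ->
    prime q.+1 -> N ^ 2 < q.+1 -> 0 < m -> 2 * M = q.+2 ->
    32 * trunc_log 2 N * (8 * m) ^ d <= q.+1 ^ d ->
  exists S : {set 'I_N.+1}, [/\ forall i, i \in S -> 0 < i,
    forall x y z, (x, y, z) \in square_aps N ->
      x \in S -> y \in S -> z \in S -> False &
    3 * N <= 8 * 2 ^ d * #|S| * (4 * s * M ^ 2 %/ (d * m ^ 2)).+1].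
Proof.
move=> N1 d0 s0 ds q_pr Nq m0 Mq mq.
have M0 : 0 < M by lia.
have w0 : 0 < d * m ^ 2 by rewrite muln_gt0 d0 expn_gt0 m0.
have [A0 [A0w A0M]] := @spherical_shell d M (d * m ^ 2) s M0 w0 s0 ds.
have Mle : M <= q.+1 by lia.
pose e (x : {ffun 'I_d -> 'I_M}) : {ffun 'I_d -> 'I_q.+1} :=
  [ffun i => widen_ord Mle (x i)].
have eE x i : e x i = x i :> nat by rewrite ffunE.
have e_inj : injective e.
  by move=> x y /ffunP exy; apply/ffunP => i; apply/ord_inj; rewrite -!eE exy.
pose pos := [set i : 'I_N.+1 | 0 < i].
have cardpos : #|pos| = N.
  have := cardsC [set (ord0 : 'I_N.+1)]; rewrite cards1 card_ord add1n => -[] cardN; rewrite -[RHS]cardN.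
  by apply: eq_card => i; rewrite !inE lt0n.
pose B := [set y : {ffun 'I_d -> 'I_q.+1} | \sum_i znorm (y i) ^ 2 < d * m ^ 2].
have cardV : #|{: {ffun 'I_d -> 'I_q.+1}}| = q.+1 ^ d by rewrite card_ffun !card_ord.
have l0 : 0 < trunc_log 2 N by rewrite trunc_log_gt0 N1.
have Tap x y z : (x, y, z) \in square_aps N ->
    [/\ x ^ 2 < y ^ 2, y ^ 2 <= N ^ 2 & z ^ 2 = y ^ 2 + (y ^ 2 - x ^ 2)].
  rewrite inE /= => /and3P[x0 xz /eqP eq]; rewrite leq_exp2r // leq_ord.
  have : x ^ 2 < z ^ 2 by rewrite ltn_exp2r.
  by split=> //; lia.
have [] := @random_affine_copy {ffun 'I_d -> 'I_q.+1} 'I_N.+1 pos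
  (fun i => i ^ 2) (square_aps N) (e @: A0) B.
- by move=> x y z /Tap[lt _ ->]; rewrite ltnW.
- move=> x y z /Tap[lt leN _]; apply: mulrn_ffun_Zp_inj => //.
  by rewrite subn_gt0 lt /=; apply: leq_ltn_trans Nq; apply: leq_trans leN; apply: leq_subr.
- move=> _ v /imsetP[a aA ->] /imsetP[b bA bE] /imsetP[c cA cE].
  rewrite inE -(ltn_pmul2l (isT : 0 < 2)) -(ltn_add2r (2 * sqnorm b)).
  apply: leq_ltn_trans (_ : sqnorm a + sqnorm c < _); last first.
    have := A0w _ _ aA bA; have := A0w _ _ cA bA; lia.
  rewrite /sqnorm !big_distrr -!big_split /=; apply: leq_sum => i _.
  apply: (@halfcube_step _ M); rewrite ?ltn_ord //; first by lia.
    by rewrite -!eE -bE ffunE.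
  by rewrite -!eE -cE ffunE bE.
- rewrite cardpos cardV mulnA.
  apply: leq_trans (_ : 2 * (16 * trunc_log 2 N * N) * (8 * m) ^ d <= _).
    apply: leq_mul; last exact: card_small_steps.
    rewrite leq_mul2l /=.
    apply: leq_trans (card_square_aps N) _.
    by rewrite mulnA leq_mul2r; apply/orP; right; lia.
  have -> : 2 * (16 * trunc_log 2 N * N) * (8 * m) ^ d =
    N * (32 * trunc_log 2 N * (8 * m) ^ d) by ring.
  by rewrite leq_mul2l mq orbT.
move=> S [Spos Sap Scard]; exists S; split=> //.
  by move=> i /(subsetP Spos); rewrite inE.
move: Scard; rewrite cardpos cardV card_imset // => Scard.
set J := (_ %/ _).+1 in A0M *.
rewrite -(leq_pmul2r (_ : 0 < M ^ d)) ?expn_gt0 ?M0 //.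
have qM : q.+1 ^ d <= 2 ^ d * M ^ d by rewrite -expnMn Mq leq_exp2r // leqnSn.
apply: leq_trans (_ : N * (3 * M ^ d) <= _); first by rewrite mulnAC mulnC.
apply: leq_trans (_ : N * (4 * #|A0| * J) <= _); first by rewrite leq_mul2l A0M orbT.
apply: leq_trans (_ : 4 * J * (2 * (2 ^ d * M ^ d) * #|S|) <= _).
  have -> : N * (4 * #|A0| * J) = 4 * J * (N * #|A0|) by ring.
  rewrite leq_mul2l; apply/orP; right; apply: leq_trans Scard _.
  by rewrite leq_mul2r leq_mul2l qM !orbT.
by rewrite leq_eqVlt; apply/orP; left; apply/eqP; ring.
Qed.

(** * Choice of the parameters *)

(** With [l] in the place of [log N], [d] is the least integer above
[sqrt (2 * log (2 * l))], and [m] is the largest window parameter for which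
deletion is affordable.  Maximality of [m] gives the reverse inequality with
[16 * m], and minimality of [d] gives [d * m ^ 2 <= p ^ 2], so that rounding up the
number of windows costs only a constant factor. *)
Lemma square_ap_free_parameters N : 1 < N ->
  exists (S : {set 'I_N.+1}) (d s p m : nat),
    [/\ forall i, i \in S -> 0 < i,
        forall x y z, (x, y, z) \in square_aps N ->
          x \in S -> y \in S -> z \in S -> False &
    [/\ [/\ 0 < d, 0 < p & 0 < m], s ^ 2 <= 4 * d,
        2 ^ (d.-1 ^ 2) <= (2 * trunc_log 2 N) ^ 2 <= 2 ^ (d ^ 2),
        p ^ d <= 32 * trunc_log 2 N * (16 * m) ^ d &
        3 * N * (d * m ^ 2) <= 40 * 2 ^ d * #|S| * s * p ^ 2]].
Proof.
move=> N1; set l := trunc_log 2 N.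
have l0 : 0 < l by rewrite trunc_log_gt0 N1.
have exd : exists d, (2 * l) ^ 2 <= 2 ^ (d ^ 2).
  exists ((2 * l) ^ 2); apply: leq_trans (ltnW (ltn_expl _ (isT : 1 < 2))) _.
  by rewrite leq_exp2l // -{1}[_ ^ 2]expn1 leq_pexp2l // expn_gt0 muln_gt0 l0.
case: (ex_minnP exd) => d dP dmin.
have d0 : 0 < d by case: d dP {dmin} => //; rewrite exp0n // expn0; nia.
have dlow : 2 ^ (d.-1 ^ 2) <= (2 * l) ^ 2.
  by rewrite leqNgt; apply/negP => /ltnW /dmin; lia.
have exs : exists s, d <= s ^ 2 by exists d; nia.
case: (ex_minnP exs) => s sP smin.
have s0 : 0 < s by case: s sP {smin} => //; lia.
have s4 : s ^ 2 <= 4 * d.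
  have : s.-1 ^ 2 < d by rewrite ltnNge; apply/negP => /smin; lia.
  by case: s {sP smin} s0 => [|[|s]] // _ /=; nia.
(* [p] exceeds [N ^ 2] so that differences of squares are invertible, and
   [256 * l] so that [m = 1] is admissible. *)
have [p] := prime_above (maxn (maxn (N ^ 2) (256 * l)) 2).
rewrite !gtn_max -andbA => /and3P[Np lp p2] p_pr.
case: p p_pr Np lp p2 => // q q_pr Nq lq q2.
pose P m := 32 * l * (8 * m) ^ d <= q.+1 ^ d.
have P1 : P 1.
  rewrite /P muln1; apply: leq_trans (_ : (256 * l) ^ d <= _).
    have -> : 256 * l = (32 * l) * 8 by ring.
    rewrite expnMn leq_mul2r -{1}[32 * l]expn1 leq_pexp2l ?orbT //.
    by rewrite muln_gt0 l0.
  by rewrite leq_exp2r // ltnW.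
have exm : exists m, P m by exists 1.
have Pb m : P m -> m <= q.+1.
  move=> Pm; rewrite -(leq_exp2r m q.+1 d0); apply: leq_trans Pm.
  rewrite expnMn mulnA -{1}[m ^ d]mul1n leq_mul2r; apply/orP; right.
  by rewrite !muln_gt0 l0 expn_gt0.
case: (ex_maxnP exm Pb) => m Pm mmax.
have m0 : 0 < m by apply: mmax.
have pm : q.+1 ^ d <= 32 * l * (16 * m) ^ d.
  have : ~~ P m.+1 by apply/negP => /mmax; rewrite ltnn.
  rewrite -ltnNge => /ltnW h; apply: leq_trans h _.
  rewrite leq_mul2l; apply/orP; right.
  by rewrite leq_exp2r //; lia.
have dm : d * m ^ 2 <= q.+1 ^ 2.
  rewrite -(leq_exp2r _ _ d0) -[leqRHS]expnM [2 * d]mulnC expnM.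
  apply: leq_trans (_ : (32 * l * (8 * m) ^ d) ^ 2 <= _); last by rewrite leq_exp2r.
  have : 2 ^ (d ^ 2) <= (2 * l) ^ 2 * 2 ^ (2 * d).
    have -> : d ^ 2 = d.-1 ^ 2 + (2 * d - 1) by clear -d0; nia.
    by rewrite expnD leq_mul // leq_exp2l // leq_subr.
  have dd : d ^ d <= 2 ^ (d ^ 2).
    by rewrite -mulnn expnM leq_exp2r // ltnW // ltn_expl.
  have -> : (32 * l * (8 * m) ^ d) ^ 2
      = 256 * ((2 * l) ^ 2 * 2 ^ (2 * d)) * (16 ^ d * (m ^ 2) ^ d).
    have -> : 2 ^ (2 * d) = 4 ^ d by rewrite expnM.
    have -> : (8 * m) ^ d = 8 ^ d * m ^ d by rewrite expnMn.
    have -> : (m ^ 2) ^ d = (m ^ d) ^ 2 by rewrite -!expnM mulnC.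
    have -> : 16 ^ d = 2 ^ d * 8 ^ d by rewrite -expnMn.
    have e84 : 8 ^ d = 2 ^ d * 4 ^ d by rewrite -expnMn.
    have e42 : 4 ^ d = 2 ^ d * 2 ^ d by rewrite -expnMn.
    by rewrite e84 e42; ring.
  move=> h; rewrite expnMn.
  apply: leq_trans (_ : ((2 * l) ^ 2 * 2 ^ (2 * d)) * (m ^ 2) ^ d <= _).
    by rewrite leq_mul2r (leq_trans dd h) orbT.
  by apply: leq_mul; [apply: leq_pmull | apply: leq_pmull; rewrite expn_gt0].
have oddq : odd q.+1 by case: (even_prime q_pr) q2 => [->|].
pose M := q.+2./2.
have Mq : 2 * M = q.+2.
  by rewrite mul2n -[RHS]odd_double_half; move: oddq => /= /negPf ->.
have Mle : M <= q.+1 by clear -Mq q2; lia.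
have [S [Spos Sap Scard]] := @square_ap_free_subset N d s q m M N1 d0 s0 sP q_pr Nq m0 Mq Pm.
exists S, d, s, q.+1, m; split=> //; split=> //; first by rewrite dlow.
have Jle : (4 * s * M ^ 2 %/ (d * m ^ 2)).+1 * (d * m ^ 2) <= 5 * s * q.+1 ^ 2.
  have -> : 5 * s * q.+1 ^ 2 = s * q.+1 ^ 2 + 4 * s * q.+1 ^ 2 by ring.
  rewrite mulSn; apply: leq_add.
    by rewrite (leq_trans dm) // leq_pmull.
  apply: leq_trans (leq_divM _ _) _.
  by rewrite leq_mul2l leq_exp2r ?Mle ?orbT.
apply: leq_trans (_ : 8 * 2 ^ d * #|S| * (5 * s * q.+1 ^ 2) <= _).
  apply: leq_trans (leq_mul (leqnn _) Jle).
  by rewrite [leqRHS]mulnA leq_mul2r Scard orbT.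
by rewrite leq_eqVlt; apply/orP; left; apply/eqP; ring.
Qed.

(** * Asymptotic estimates *)

Section Log2.
Local Open Scope ring_scope.
Variable R : realType.
Implicit Types x y : R.

Let ln2_gt0 : 0 < ln 2 :> R. Proof. by rewrite ln_gt0 // ltr1n. Qed.

Lemma exp2_gt0 x : 0 < exp2 x. Proof. exact: powR_gt0. Qed.

Lemma exp2D x y : exp2 (x + y) = exp2 x * exp2 y.
Proof. by rewrite /exp2 powRD // pnatr_eq0 implybT. Qed.

Lemma exp2_nat n : exp2 n%:R = 2 ^+ n :> R.
Proof. exact: powR_mulrn. Qed.

Lemma ler_exp2 x y : x <= y -> exp2 x <= exp2 y.
Proof. by apply: ler_powR; rewrite ler1n. Qed.

Lemma log2K x : 0 < x -> exp2 (log2 x) = x.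
Proof.
move=> x0; rewrite /exp2 /powR pnatr_eq0 /log2 mulfVK ?gt_eqF //.
exact: lnK.
Qed.

Lemma exp2K x : log2 (exp2 x) = x.
Proof. by rewrite /log2 /exp2 ln_powR mulfK ?gt_eqF. Qed.

Lemma ler_log2 x y : 0 < x -> x <= y -> log2 x <= log2 y.
Proof.
move=> x0 xy; rewrite ler_pM2r ?invr_gt0 // ler_ln ?posrE //.
exact: lt_le_trans xy.
Qed.

Lemma log2M x y : 0 < x -> 0 < y -> log2 (x * y) = log2 x + log2 y.
Proof. by move=> x0 y0; rewrite /log2 lnM ?posrE // mulrDl. Qed.

Lemma log2X x n : 0 < x -> log2 (x ^+ n) = n%:R * log2 x.
Proof. by move=> x0; rewrite /log2 lnXn // mulr_natl mulrnAl. Qed.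

Lemma log2_2X n : log2 (2 ^+ n) = n%:R :> R.
Proof. by rewrite -exp2_nat exp2K. Qed.

Lemma log2_2Xn n : log2 ((2 ^ n)%N%:R : R) = n%:R.
Proof. by rewrite natrX log2_2X. Qed.

Lemma log2_bounds N : (1 < N)%N ->
  (trunc_log 2 N)%:R <= log2 (N%:R : R) <= 2 * (trunc_log 2 N)%:R.
Proof.
move=> N1; have /andP[lo hi] := @trunc_log_bounds 2 N isT (ltnW N1).
have l0 : (0 < trunc_log 2 N)%N by rewrite trunc_log_gt0 N1.
rewrite -natrM -(log2_2Xn (trunc_log 2 N)) -(log2_2Xn (2 * _)%N) !ler_log2 ?ltr0n ?expn_gt0 ?ler_nat ?(ltnW N1) //.
by rewrite (leq_trans (ltnW hi)) // leq_exp2l //; lia.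
Qed.

End Log2.
Arguments log2_bounds R {N}.

Section Estimate.
Local Open Scope ring_scope.
Variable R : realType.

(** The dyadic conditions say that [d] is [sqrt (2 * log (2 * l))] rounded up, and
[2 * l] lies between [log N] and [2 * log N]. *)
Lemma dimension_bounds (N d : nat) (t : R) : (1 < N)%N -> (0 < d)%N ->
    (2 ^ (d.-1 ^ 2) <= (2 * trunc_log 2 N) ^ 2 <= 2 ^ (d ^ 2))%N ->
    0 < t -> log2 (log2 N%:R) = t ^+ 2 ->
  Num.sqrt 2 * t <= d%:R <= Num.sqrt 2 * t + 3.
Proof.
move=> N1 d0 /andP[dlow dup] t0 tE.
have /andP[lo hi] := log2_bounds R N1.
set l := trunc_log 2 N in lo hi dlow dup.
have l0 : (0 < l)%N by rewrite trunc_log_gt0 N1.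
have lR : 0 < l%:R :> R by rewrite ltr0n.
have x0 : 0 < log2 (N%:R : R) by apply: lt_le_trans lo.
have up : t ^+ 2 <= log2 (2 * l%:R) by rewrite -tE ler_log2.
have low : log2 (2 * l%:R) <= t ^+ 2 + 1.
  by rewrite log2M // -{1}[2]expr1 log2_2X addrC lerD2r -tE ler_log2.
have sqE : log2 (((2 * l) ^ 2)%:R : R) = 2 * log2 (2 * l%:R).
  by rewrite natrX natrM log2X // mulr_gt0.
have dup2 : 2 * t ^+ 2 <= d%:R ^+ 2.
  have : log2 (((2 * l) ^ 2)%:R : R) <= (d ^ 2)%:R.
    by rewrite -(log2_2Xn R (d ^ 2)%N) ler_log2 ?ler_nat // ltr0n expn_gt0 muln_gt0 l0.
  rewrite sqE natrX; lra.
have dlow2 : (d%:R - 1) ^+ 2 <= 2 * t ^+ 2 + 2.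
  have : (d.-1 ^ 2)%:R <= log2 (((2 * l) ^ 2)%:R : R).
    by rewrite -(log2_2Xn R (d.-1 ^ 2)%N) ler_log2 ?ler_nat // ltr0n expn_gt0.
  by rewrite sqE natrX -subn1 natrB //; lra.
have d1 : 1 <= d%:R :> R by rewrite ler1n.
have r0 : 0 < Num.sqrt 2 :> R by rewrite sqrtr_gt0.
have r2 : Num.sqrt 2 ^+ 2 = 2 :> R by rewrite sqr_sqrtr.
have rt : (Num.sqrt 2 * t) ^+ 2 = 2 * t ^+ 2 by rewrite exprMn r2.
have rt0 : 0 < Num.sqrt 2 * t by rewrite mulr_gt0.
rewrite -rt in dup2 dlow2; move: (Num.sqrt 2 * t) rt0 dup2 dlow2 => u u0 dup2 dlow2.
by apply/andP; split; nra.
Qed.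

(** Taking logarithms, [log (p / m) <= 4 + (5 + log l) / d], and
[log l <= t ^ 2 <= t * d / sqrt 2]. *)
Lemma ratio_bound (N d p m : nat) (t : R) : (1 < N)%N ->
    (0 < d)%N -> (0 < p)%N -> (0 < m)%N ->
    (p ^ d <= 32 * trunc_log 2 N * (16 * m) ^ d)%N ->
    0 < t -> log2 (log2 N%:R) = t ^+ 2 -> Num.sqrt 2 * t <= d%:R ->
  p%:R ^+ 2 <= exp2 (18 + Num.sqrt 2 * t) * m%:R ^+ 2.
Proof.
move=> N1 d0 p0 m0 pm t0 tE td.
have /andP[lo _] := log2_bounds R N1.
set l := trunc_log 2 N in lo pm.
have l0 : (0 < l)%N by rewrite trunc_log_gt0 N1.
have lR : 0 < l%:R :> R by rewrite ltr0n.
have pR : 0 < p%:R :> R by rewrite ltr0n.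
have mR : 0 < m%:R :> R by rewrite ltr0n.
have d1 : 1 <= d%:R :> R by rewrite ler1n.
have lt2 : log2 (l%:R : R) <= t ^+ 2 by rewrite -tE ler_log2.
have pmR : p%:R ^+ d <= 2 ^+ 5 * l%:R * (2 ^+ 4 * m%:R) ^+ d :> R.
  have pm' : (p ^ d <= 2 ^ 5 * l * (2 ^ 4 * m) ^ d)%N by [].
  by move: pm'; rewrite -(ler_nat R) !(natrX, natrM).
have := ler_log2 _ _ _ (exprn_gt0 d pR) pmR.
have log2_2 : log2 (2 : R) = 1 by rewrite -[2]expr1 log2_2X.
rewrite !(log2X, log2M) ?mulr_gt0 ?exprn_gt0 ?mulr_gt0 ?exprn_gt0 // log2_2 => main.
have r0 : 0 < Num.sqrt 2 :> R by rewrite sqrtr_gt0.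
have r2 : Num.sqrt 2 ^+ 2 = 2 :> R by rewrite sqr_sqrtr.
have key : 2 * log2 (p%:R : R) <= 18 + Num.sqrt 2 * t + 2 * log2 (m%:R : R).
  rewrite -(ler_pM2l (_ : 0 < d%:R :> R)); last by lra.
  have : Num.sqrt 2 * t * d%:R >= 2 * t ^+ 2.
    have <- : (Num.sqrt 2 * t) ^+ 2 = 2 * t ^+ 2 by rewrite exprMn r2.
    by rewrite expr2 ler_pM2l // mulr_gt0.
  move: main; move: (log2 _) (log2 _) (log2 _) lt2 => P M L lt2; nra.
have sqE x : 0 < x -> x ^+ 2 = exp2 (2 * log2 x) :> R.
  by move=> x0; rewrite -log2X // log2K // exprn_gt0.
by rewrite !sqE // -exp2D ler_exp2.
Qed.

(** As [s] is at most [2 * sqrt d], dividing the count by [s] leaves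
[c >= const * N * sqrt d * 2 ^ (- d) * (m / p) ^ 2].  Both [d] and [2 * log (p / m)] are
[sqrt 2 * t] up to a constant, and [sqrt d] is at least [(log (log N)) ^ (1 / 4)]. *)
Lemma size_bound (N d s p m c : nat) : (3 <= N)%N ->
    (0 < d)%N -> (0 < p)%N -> (0 < m)%N -> (s ^ 2 <= 4 * d)%N ->
    (2 ^ (d.-1 ^ 2) <= (2 * trunc_log 2 N) ^ 2 <= 2 ^ (d ^ 2))%N ->
    (p ^ d <= 32 * trunc_log 2 N * (16 * m) ^ d)%N ->
    (3 * N * (d * m ^ 2) <= 40 * 2 ^ d * c * s * p ^ 2)%N ->
  3 / (80 * 2 ^+ 21) * N%:R *
      exp2 (- (2 * Num.sqrt 2) * Num.sqrt (log2 (log2 N%:R))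
            + 1 / 4 * log2 (log2 (log2 N%:R))) <= c%:R :> R.
Proof.
move=> N3 d0 p0 m0 sd dP pm count.
have N1 : (1 < N)%N by apply: ltn_trans N3.
set L := log2 (log2 (N%:R : R)).
have L0 : 0 < L.
  have log2_gt0 x : 1 < x -> 0 < log2 x :> R.
    by move=> x1; rewrite divr_gt0 // ln_gt0 // ltr1n.
  apply/log2_gt0; rewrite -[X in X < _](log2_2Xn R 1) /log2.
  rewrite ltr_pM2r ?invr_gt0 ?ln_gt0 ?ltr1n // ltr_ln ?posrE ?ltr0n //.
    by rewrite ltr_nat.
  exact: ltnW.
set t := Num.sqrt L.
have t0 : 0 < t by rewrite sqrtr_gt0.
have tE : L = t ^+ 2 by rewrite sqr_sqrtr // ltW.
have /andP[td dt] := @dimension_bounds N d t N1 d0 dP t0 tE.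
have pm2 := @ratio_bound N d p m t N1 d0 p0 m0 pm t0 tE td.
have r0 : 0 < Num.sqrt 2 :> R by rewrite sqrtr_gt0.
have r2 : Num.sqrt 2 ^+ 2 = 2 :> R by rewrite sqr_sqrtr.
have dR : 0 < d%:R :> R by rewrite ltr0n.
have mR : 0 < m%:R :> R by rewrite ltr0n.
pose sg : R := Num.sqrt d%:R.
have sg0 : 0 < sg by rewrite sqrtr_gt0.
have sgE : sg ^+ 2 = d%:R by rewrite sqr_sqrtr // ltW.
have s_le : s%:R <= 2 * sg.
  have s2 : s%:R ^+ 2 <= (2 * sg) ^+ 2.
    by rewrite exprMn sgE -!natrX -natrM ler_nat.
  by rewrite ler_sqr ?nnegrE // in s2; rewrite mulr_ge0 // ltW.
have L_le : exp2 (1 / 4 * log2 L) <= sg.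
  have -> : sg = exp2 (1 / 4 * log2 (d%:R ^+ 2)).
    rewrite -sgE -exprM log2X // mulrA -[LHS]log2K //; congr (exp2 _).
    by field.
  apply: ler_exp2; apply: ler_wpM2l; first lra.
  apply: ler_log2 => //; rewrite tE.
  have : (Num.sqrt 2 * t) ^+ 2 <= d%:R ^+ 2.
    by rewrite ler_sqr ?nnegrE //; rewrite mulr_ge0 // ltW.
  by rewrite exprMn r2; have := exprn_ge0 2 (ltW t0); lra.
have countR : 3 * N%:R * (d%:R * m%:R ^+ 2) <= 40 * 2 ^+ d * c%:R * s%:R * p%:R ^+ 2 :> R.
  by move: count; rewrite -(ler_nat R) !(natrM, natrX).
set X := exp2 (2 * Num.sqrt 2 * t).
have X0 : 0 < X by apply: exp2_gt0.
have main : 3 * N%:R * sg <= 80 * 2 ^+ 21 * X * c%:R.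
  have step : 2 ^+ d * p%:R ^+ 2 <= 2 ^+ 21 * X * m%:R ^+ 2.
    apply: le_trans (_ : exp2 (Num.sqrt 2 * t + 3) * (exp2 (18 + Num.sqrt 2 * t) * m%:R ^+ 2) <= _).
      by rewrite ler_pM ?exprn_ge0 // -exp2_nat ler_exp2.
    rewrite mulrA -exp2D /X -exp2_nat -exp2D le_eqVlt; apply/orP; left; apply/eqP.
    by congr (exp2 _ * _); lra.
  rewrite -(ler_pM2r (_ : 0 < sg * m%:R ^+ 2)); last by rewrite mulr_gt0 ?exprn_gt0.
  have -> : 3 * N%:R * sg * (sg * m%:R ^+ 2) = 3 * N%:R * (d%:R * m%:R ^+ 2).
    by rewrite -sgE; ring.
  apply: le_trans countR _.
  have -> : 40 * 2 ^+ d * c%:R * s%:R * p%:R ^+ 2 = (40 * c%:R) * (s%:R * (2 ^+ d * p%:R ^+ 2)) :> R.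
    by ring.
  have -> : 80 * 2 ^+ 21 * X * c%:R * (sg * m%:R ^+ 2)
          = (40 * c%:R) * ((2 * sg) * (2 ^+ 21 * X * m%:R ^+ 2)) by ring.
  by rewrite ler_wpM2l ?mulr_ge0 // ler_pM // mulr_ge0 ?exprn_ge0.
rewrite exp2D.
have -> : exp2 (- (2 * Num.sqrt 2) * t) = X^-1.
  by rewrite /X /exp2 mulNr powRN.
apply: le_trans (_ : 3 / (80 * 2 ^+ 21) * N%:R * (X^-1 * sg) <= _).
  apply: ler_wpM2l; last by rewrite ler_pM2l ?invr_gt0.
  by rewrite mulr_ge0 // divr_ge0 // mulr_ge0 // exprn_ge0.
have -> : 3 / (80 * 2 ^+ 21) * N%:R * (X^-1 * sg) = 3 * N%:R * sg / (80 * 2 ^+ 21 * X).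
  by field; rewrite gt_eqF.
by rewrite ler_pdivrMr ?mulr_gt0 ?exprn_gt0 // [leRHS]mulrC.
Qed.

End Estimate.

Local Open Scope ring_scope.

Theorem corollary1 (R : realType) :
  exists C : R, 0 < C /\
    forall N : nat, (3 <= N)%N ->
      exists A : {fset int},
        [/\ (A `<=` first_squares N)%fset,
            ~ has_3ap A
          & C * N%:R *
              exp2 (- (2 * Num.sqrt 2) * Num.sqrt (log2 (log2 N%:R))
                    + 1 / 4 * log2 (log2 (log2 N%:R)))
            <= #|` A|%:R].
Proof.
exists (3 / (80 * 2 ^+ 21)); split; first by rewrite divr_gt0 ?mulr_gt0.
move=> N N3.
have [S [d [s [p [m [Spos Sap [[d0 p0 m0] sd dP pm count]]]]]]] :=
  @square_ap_free_parameters N (ltn_trans (isT : (1 < 2)%N) N3).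
pose sq (i : 'I_N.+1) : int := (i : nat)%:Z ^+ 2.
have sq_inj : injective sq.
  move=> i j /eqP; rewrite eqrXn2 // => /eqP [] ij; exact: val_inj.
exists [fset sq i | i in S]%fset; split.
- apply/fsubsetP => _ /imfsetP[i /= iS ->]; apply/imfsetP; exists (i : nat) => //=.
  by rewrite mem_iota Spos // add1n ltn_ord.
- move=> [a [e [e0 /imfsetP[x /= xS ax] /imfsetP[y /= yS ay] /imfsetP[z /= zS az]]]].
  have eq : (x ^ 2 + z ^ 2 = 2 * y ^ 2)%N by clear -ax ay az; rewrite /sq in ax ay az; lia.
  have [xz|zx|xz] := ltngtP x z.
  + apply: (Sap x y z) => //; rewrite inE /= Spos // xz; exact/eqP.
  + apply: (Sap z y x) => //; rewrite inE /= Spos // zx /= addnC; exact/eqP.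
  + by clear -az e0 ax xz; rewrite -(val_inj xz) -ax in az; lia.
rewrite card_imfset //= -cardE.
exact: size_bound N3 d0 p0 m0 sd dP pm count.
Qed.
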